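(* Let $\bm{A}\in\mathbb{R}^{d\times n}$, $\bm{y}\in\mathbb{R}^{d}$, $\bm{L}\in\mathbb{R}^{m\times n}$, $\bm{B}\in\mathbb{R}^{q\times m}$, $\lambda>0$, and let $\varphi\in\Gamma_0(\mathbb{R}^{m}\times\mathbb{R}^{l})$ be bounded below and such that $\varphi(\bm{u},\cdot)$ is proper and coercive for every $\bm{u}\in\mathbb{R}^{m}$. Let $\psi$, $\Psi_{\bm{B}}$ and $J$ be defined from these data as in the context, and set $$\bm{Q}:=\bm{A}^{\top}\bm{A}-\lambda\bm{L}^{\top}\bm{B}^{\top}\bm{B}\bm{L}.$$ Then, for every $\bm{x}\in\mathbb{R}^{n}$, $$J(\bm{x})=\frac12\langle\bm{x},\bm{Q}\bm{x}\rangle-\langle\bm{y},\bm{A}\bm{x}\rangle+\frac12\|\bm{y}\|^2+\lambda\psi(\bm{L}\bm{x})+\lambda\left(\psi+\frac12\|\bm{B}\cdot\|^2\right)^{*}(\bm{B}^{\top}\bm{B}\bm{L}\bm{x}).$$ Moreover, $J\in\Gamma_0(\mathbb{R}^{n})$ if $\bm{Q}\succeq\bm{O}$ (i.e., $\bm{Q}$ is positive semidefinite).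
   Context: Euclidean spaces carry the standard inner product $\langle\cdot,\cdot\rangle$ and norm $\|\cdot\|$. $\Gamma_0(\mathbb{R}^{N})$ is the set of proper lower semicontinuous convex functions from $\mathbb{R}^{N}$ to $\mathbb{R}\cup\{\infty\}$; $f$ is proper if $\mathrm{dom}(f)=\{\bm{x}\mid f(\bm{x})<\infty\}\neq\varnothing$. A function $f:\mathbb{R}^N\to\mathbb{R}\cup\{\infty\}$ is coercive if $f(\bm{x})\to\infty$ as $\|\bm{x}\|\to\infty$. The conjugate of $f$ is $f^{*}(\bm{w})=\sup_{\bm{x}}[\langle\bm{x},\bm{w}\rangle-f(\bm{x})]$. The minimization induced (MI) penalty is $\psi:\mathbb{R}^{m}\to\mathbb{R}$, $\psi(\bm{u})=\min_{\bm{\sigma}\in\mathbb{R}^{l}}\varphi(\bm{u},\bm{\sigma})$ (the minimum is attained under the assumptions on $\varphi$). The GME-MI penalty is $\Psi_{\bm{B}}:\mathbb{R}^{m}\to\mathbb{R}\cup\{\infty\}$, $$\Psi_{\bm{B}}(\bm{u})=\psi(\bm{u})-\inf_{\bm{v}\in\mathbb{R}^{m}}\left[\psi(\bm{v})+\frac12\|\bm{B}(\bm{u}-\bm{v})\|^2\right].$$ The cost function is $J(\bm{x})=\frac12\|\bm{y}-\bm{A}\bm{x}\|^2+\lambda\Psi_{\bm{B}}(\bm{L}\bm{x})$ for $\bm{x}\in\mathbb{R}^{n}$. *)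

(* Defs.v *)
From mathcomp Require Import all_boot all_order all_algebra.
From mathcomp Require Import all_classical all_reals all_analysis.

Set Implicit Arguments.
Unset Strict Implicit.
Unset Printing Implicit Defensive.

Import Order.TTheory GRing.Theory Num.Theory.
Import numFieldNormedType.Exports.

Local Open Scope classical_set_scope.
Local Open Scope ring_scope.
Local Open Scope ereal_scope.

Definition dotp (R : realType) (N : nat) (x w : 'cV[R]_N) : R :=
  (\sum_(i < N) x i ord0 * w i ord0)%R.

(* The library norm on 'cV[R]_N is the sup norm, hence a separate Euclidean
   norm; the two induce the same topology. *)
Definition enorm (R : realType) (N : nat) (x : 'cV[R]_N) : R :=
  Num.sqrt (dotp x x).

Definition psdmx (R : realType) (N : nat) (M : 'M[R]_N) : Prop :=
  M^T = M /\ forall x : 'cV[R]_N, (0 <= dotp x (M *m x))%R.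

(* Functions with values in R \cup {+oo} are functions to \bar R which never
   take the value -oo; this is made part of properness. *)
Definition proper_fun (R : realType) (T : Type) (f : T -> \bar R) : Prop :=
  (forall x, -oo < f x) /\ (exists x, f x < +oo).

(* At t = 0 and t = 1 the convention 0 * +oo = 0 makes the inequality
   trivial. *)
Definition convex_fun (R : realType) (E : lmodType R) (f : E -> \bar R) : Prop :=
  forall (x y : E) (t : R), (0 <= t <= 1)%R ->
    f (t *: x + (1 - t) *: y)%R <= t%:E * f x + (1 - t)%:E * f y.

Definition Gamma0 (R : realType) (E : normedModType R) (f : E -> \bar R) : Prop :=
  [/\ proper_fun f, lower_semicontinuous f & convex_fun f].

Definition coercive (R : realType) (N : nat) (f : 'cV[R]_N -> \bar R) : Prop :=
  forall c : R, exists r : R, forall x, (r < enorm x)%R -> c%:E < f x.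

Definition bounded_below (R : realType) (T : Type) (f : T -> \bar R) : Prop :=
  exists c : R, forall x, c%:E <= f x.

Definition conjugate (R : realType) (N : nat) (f : 'cV[R]_N -> \bar R)
    (w : 'cV[R]_N) : \bar R :=
  ereal_sup [set (dotp x w)%:E - f x | x in [set: 'cV[R]_N]].

(* The minimum is encoded as an infimum; it is attained and finite for the
   functions phi of interest, see MI_penalty_attained and
   MI_penalty_fin_num. *)
Definition MI_penalty (R : realType) (m l : nat)
    (phi : 'cV[R]_m * 'cV[R]_l -> \bar R) (u : 'cV[R]_m) : \bar R :=
  ereal_inf [set phi (u, s) | s in [set: 'cV[R]_l]].

Definition GME_MI_penalty (R : realType) (m l q : nat)
    (phi : 'cV[R]_m * 'cV[R]_l -> \bar R) (B : 'M[R]_(q, m))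
    (u : 'cV[R]_m) : \bar R :=
  MI_penalty phi u -
  ereal_inf [set MI_penalty phi v + (2^-1 * enorm (B *m (u - v)) ^+ 2)%:E
            | v in [set: 'cV[R]_m]].

Definition cost (R : realType) (d n m l q : nat)
    (A : 'M[R]_(d, n)) (y : 'cV[R]_d) (L : 'M[R]_(m, n)) (B : 'M[R]_(q, m))
    (lambda : R) (phi : 'cV[R]_m * 'cV[R]_l -> \bar R) (x : 'cV[R]_n) : \bar R :=
  (2^-1 * enorm (y - A *m x) ^+ 2)%:E
  + lambda%:E * GME_MI_penalty phi B (L *m x).

Lemma abs_coord_le_enorm (R : realType) (N : nat) (x : 'cV[R]_N) (i : 'I_N) :
  (`|x i ord0| <= enorm x)%R.
Proof.
have ge0 (P : pred 'I_N) : (0 <= \sum_(k < N | P k) x k ord0 * x k ord0)%R.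
  by apply: sumr_ge0 => k _; rewrite -expr2 sqr_ge0.
rewrite -sqrtr_sqr ler_sqrt; last exact: ge0.
by rewrite /dotp (bigD1 i) //= expr2 lerDl; exact: ge0.
Qed.

Lemma lsc_compact_attained (R : realType) (T : topologicalType)
    (f : T -> \bar R) (K : set T) :
  lower_semicontinuous f -> bounded_below f -> compact K -> K !=set0 ->
  exists2 s, K s & forall x, K x -> f s <= f x.
Proof.
move=> lscf [c fc] cK [s0 Ks0]; apply: contrapT => nmin.
pose e := ereal_inf (f @` K).
have ef x : K x -> e < f x.
  move=> Kx; rewrite ltNge; apply/negP => fxe; apply: nmin; exists x => // z Kz.
  by apply: (le_trans fxe); apply: ereal_inf_lbound; exists z.
have ce : c%:E <= e by apply: le_ereal_inf_tmp => _ [x _ <-].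
have eoo : e < +oo by apply: (lt_le_trans (ef _ Ks0)); exact: leey.
have efin : e \is a fin_num by rewrite fin_numE; case: (e) ce eoo.
pose r := fine e.
have rE : e = r%:E by rewrite fineK.
have near_r : \forall a \near (r^'+)%classic, forall x, K x -> a%:E < f x.
  move/compact_near_coveringP: cK; apply => x Kx.
  have [a ra afx] : exists2 a : R, (r < a)%R & a%:E < f x.
    have := ef x Kx; rewrite rE; case: (f x) => [z||] //=; last first.
      by exists (r + 1)%R; rewrite ?ltrDl ?ltr01 ?ltry.
    rewrite lte_fin => rz; exists ((r + z) / 2)%R; first by rewrite midf_lt.
    by rewrite lte_fin midf_lt.
  have [V nV HV] := lscf x a afx.
  exists (V, [set b | (b < a)%R]) => /=; first by split=> //; exact: nbhs_right_lt.
  by move=> [z b] /= [Vz ba]; apply: lt_trans (HV _ Vz); rewrite lte_fin.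
have [a [ra Ha]] := filter_ex (filterI (nbhs_right_gt r) near_r).
suff : a%:E <= e by rewrite rE lee_fin leNgt ra.
by apply: le_ereal_inf_tmp => _ [x Kx <-]; apply: ltW; exact: Ha.
Qed.

Lemma MI_penalty_attained (R : realType) (m l : nat)
    (phi : 'cV[R]_m * 'cV[R]_l -> \bar R) (u : 'cV[R]_m) :
  lower_semicontinuous phi -> bounded_below phi ->
  proper_fun (fun s => phi (u, s)) -> coercive (fun s => phi (u, s)) ->
  exists s, phi (u, s) = MI_penalty phi u /\ forall t, phi (u, s) <= phi (u, t).
Proof.
move=> lscphi [c phic] [noo [s0 s0fin]] coer.
suff [s Hs] : exists s, forall t, phi (u, s) <= phi (u, t).
  exists s; split=> //; apply/eqP; rewrite eq_le; apply/andP; split.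
    by apply: le_ereal_inf_tmp => _ [t _ <-].
  by apply: ereal_inf_lbound; exists s.
have [r Hr] := coer (fine (phi (u, s0))).
pose M := Num.max r (enorm s0).
pose K := [set v : 'rV[R]_l | forall i, v ord0 i \in `[(- M)%R, M]].
have cK : compact K.
  apply: (@rV_compact _ _ (fun=> `[(- M)%R, M]%classic)) => _.
  exact: segment_compact.
have inK s : (enorm s <= M)%R -> K s^T.
  move=> sM i; rewrite mxE in_itv /= -ler_norml.
  exact: le_trans (abs_coord_le_enorm _ _) sM.
pose g := fun v : 'rV[R]_l => phi (u, v^T).
have lscg : lower_semicontinuous g.
  move=> v a /lscphi [V [[V1 V2] /= [nV1 [P nP PV]] sV] HV].
  exists [set w | V2 w^T].
    exists (fun i j => P j i) => [i j|w wP]; first by have := nP j i; rewrite mxE.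
    by apply: PV => i j; rewrite mxE; exact: wP.
  move=> w V2w; apply: HV; apply: sV; split=> //=; exact: nbhs_singleton nV1.
have [||v Kv Hv] := lsc_compact_attained lscg _ cK.
- by exists c => v; exact: phic.
- by exists s0^T; apply: inK; rewrite le_max lexx orbT.
exists v^T => t; have [tM|Mt] := leP (enorm t) M.
  by have := Hv _ (inK _ tM); rewrite /g trmxK.
have := Hv _ (inK s0 _); rewrite /g trmxK => /(_ _)/le_trans; apply.
  by rewrite le_max lexx orbT.
rewrite -(@fineK _ (phi (u, s0))); last first.
  by rewrite fin_numE -ltNye -ltey (noo s0) s0fin.
by apply/ltW/Hr; apply: le_lt_trans Mt; rewrite le_max lexx.
Qed.

Lemma MI_penalty_fin_num (R : realType) (m l : nat)
    (phi : 'cV[R]_m * 'cV[R]_l -> \bar R) (u : 'cV[R]_m) :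
  bounded_below phi -> proper_fun (fun s => phi (u, s)) ->
  MI_penalty phi u \is a fin_num.
Proof.
move=> [c phic] [_ [s0 s0fin]]; rewrite fin_numE -ltNye -ltey; apply/andP; split.
  by apply: (@lt_le_trans _ _ c%:E); [exact: ltNyr|apply: le_ereal_inf_tmp => _ [t _ <-]].
by apply: le_lt_trans s0fin; apply: ereal_inf_lbound; exists s0.
Qed.

(* Main.v *)
(* Expanding the square |B(u - v)|^2 turns the Moreau-type infimum into
   |Bu|^2/2 minus a conjugate evaluated at B^T B u, which gives the formula for
   the cost. In it every term is finite and, when Q is positive semidefinite,
   convex: psi as a partial minimization of a jointly convex function, the
   conjugate as a supremum of affine functions. Lower semicontinuity is then
   free, since a real-valued convex function on R^n is continuous. *)
Require Import Defs.
From mathcomp Require Import all_boot all_order all_algebra.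
From mathcomp Require Import all_classical all_reals all_analysis.
From mathcomp Require Import ring lra.

Set Implicit Arguments.
Unset Strict Implicit.
Unset Printing Implicit Defensive.

Import Order.TTheory GRing.Theory Num.Theory.
Import numFieldNormedType.Exports.

Local Open Scope ring_scope.
Local Open Scope ereal_scope.

(** * Algebra of the Euclidean inner product *)

Section dot_product.
Context {R : realType}.
Local Open Scope ring_scope.

Lemma dotpE (N : nat) (x w : 'cV[R]_N) : dotp x w = (x^T *m w) ord0 ord0.
Proof. by rewrite mxE; apply: eq_bigr => i _; rewrite mxE. Qed.

Lemma dotpC (N : nat) (x w : 'cV[R]_N) : dotp x w = dotp w x.
Proof. by apply: eq_bigr => i _; rewrite mulrC. Qed.

Lemma dotpDl (N : nat) (x z w : 'cV[R]_N) : dotp (x + z) w = dotp x w + dotp z w.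
Proof. by rewrite !dotpE linearD mulmxDl mxE. Qed.

Lemma dotpDr (N : nat) (x z w : 'cV[R]_N) : dotp w (x + z) = dotp w x + dotp w z.
Proof. by rewrite !(dotpC w) dotpDl. Qed.

Lemma dotpZl (N : nat) (a : R) (x w : 'cV[R]_N) : dotp (a *: x) w = a * dotp x w.
Proof. by rewrite !dotpE linearZ -scalemxAl mxE. Qed.

Lemma dotpZr (N : nat) (a : R) (x w : 'cV[R]_N) : dotp w (a *: x) = a * dotp w x.
Proof. by rewrite !(dotpC w) dotpZl. Qed.

Lemma dotpBl (N : nat) (x z w : 'cV[R]_N) : dotp (x - z) w = dotp x w - dotp z w.
Proof. by rewrite dotpDl -scaleN1r dotpZl mulN1r. Qed.

Lemma dotpBr (N : nat) (x z w : 'cV[R]_N) : dotp w (x - z) = dotp w x - dotp w z.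
Proof. by rewrite !(dotpC w) dotpBl. Qed.

Lemma dotp_mulmxl (N M : nat) (A : 'M[R]_(N, M)) (x : 'cV[R]_M) (w : 'cV[R]_N) :
  dotp (A *m x) w = dotp x (A^T *m w).
Proof. by rewrite !dotpE trmx_mul mulmxA. Qed.

Lemma enorm_sqr (N : nat) (x : 'cV[R]_N) : enorm x ^+ 2 = dotp x x.
Proof.
by rewrite /enorm sqr_sqrtr// sumr_ge0// => i _; rewrite -expr2 sqr_ge0.
Qed.

Lemma enorm_sqrB (N : nat) (x w : 'cV[R]_N) :
  enorm (x - w) ^+ 2 = enorm x ^+ 2 - 2 * dotp x w + enorm w ^+ 2.
Proof. by rewrite !enorm_sqr dotpBl !dotpBr (dotpC w x); ring. Qed.

End dot_product.

(** * Operations preserving convexity, and lower semicontinuity of real-valued convex functions *)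

Section convexity.
Context {R : realType}.

Lemma convex_fun_mulmx (N M : nat) (A : 'M[R]_(N, M)) (f : 'cV[R]_N -> \bar R) :
  convex_fun f -> convex_fun (fun x : 'cV[R]_M => f (A *m x)).
Proof. by move=> cf x y t t01; rewrite mulmxDr -!scalemxAr; exact: cf. Qed.

Lemma convex_funD (E : lmodType R) (f g : E -> R) :
  convex_fun (EFin \o f) -> convex_fun (EFin \o g) ->
  convex_fun (EFin \o (f \+ g)%R).
Proof.
move=> cf cg x y t t01; move: (cf x y t t01) (cg x y t t01) => /=.
by rewrite -!EFinM -!EFinD !lee_fin => ? ?; lra.
Qed.

Lemma convex_funZ (E : lmodType R) (a : R) (f : E -> R) : (0 <= a)%R ->
  convex_fun (EFin \o f) -> convex_fun (EFin \o (a \*o f)%R).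
Proof.
move=> a0 cf x y t t01; move: (cf x y t t01) => /=.
by rewrite -!EFinM -!EFinD !lee_fin => /(ler_wpM2l a0); lra.
Qed.

(** The affine part cancels from the convexity gap, which is exactly [t (1 - t) / 2] times the value
    of the quadratic form of [Q] at [x - y]. *)
Lemma convex_quadratic (N : nat) (Q : 'M[R]_N) (b : 'cV[R]_N) (c : R) :
  psdmx Q ->
  convex_fun (fun x => (2^-1 * dotp x (Q *m x) - dotp b x + c)%:E).
Proof.
move=> [_ Q0] x y t /andP[t0 t1]; rewrite -!EFinM -!EFinD lee_fin.
have := mulr_ge0 (mulr_ge0 t0 (_ : 0 <= 1 - t)%R) (Q0 (x - y)%R).
rewrite subr_ge0 => /(_ t1); rewrite mulmxBr !dotpBl !dotpBr.
rewrite mulmxDr -!scalemxAr !dotpDr !dotpDl !dotpZl !dotpZr.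
by move=> ?; lra.
Qed.

Lemma conjugate_convex (N : nat) (f : 'cV[R]_N -> \bar R) :
  (forall x, f x \is a fin_num) -> convex_fun (conjugate f).
Proof.
move=> ffin w z t /andP[t0 t1]; apply: ge_ereal_sup => _ [x _ <-].
have t1' : (0 <= 1 - t)%R by rewrite subr_ge0.
(* As [f x] is real, the affine function indexed by [x] splits along the convex combination; each
   piece is then bounded by its own supremum. *)
apply: (@le_trans _ _ (t%:E * ((dotp x w)%:E - f x)
                       + (1 - t)%:E * ((dotp x z)%:E - f x))).
  rewrite -(fineK (ffin x)) -!EFinB -!EFinM -EFinD lee_fin.
  by rewrite dotpDr !dotpZr; lra.
by apply: leeD; apply: lee_wpmul2l; rewrite ?lee_fin//;
  apply: ereal_sup_ubound; exists x.
Qed.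

(** Minimizers at [u] and [v], combined with the same weights, give a competitor at the combined
    point. Attainment avoids arguing with near-minimizers. *)
Lemma MI_penalty_convex (m l : nat) (phi : 'cV[R]_m * 'cV[R]_l -> \bar R) :
  (forall u, exists s, phi (u, s) = MI_penalty phi u) ->
  convex_fun phi -> convex_fun (MI_penalty phi).
Proof.
move=> att cphi u v t t01.
have [[s <-] [r <-]] := (att u, att v).
apply: le_trans (cphi (u, s) (v, r) t t01).
by apply: ereal_inf_lbound; eexists.
Qed.

(* Induction on the number k of coordinates in which z may differ from x: z is
   the midpoint of a point differing from x in the first k coordinates only and
   of a point of the segment [x - e_k, x + e_k]. *)
Lemma convex_locally_bounded (N : nat) (f : 'cV[R]_N -> R) (x : 'cV[R]_N) :
  convex_fun (EFin \o f) ->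
  exists M d : R, (0 < d)%R /\ forall z : 'cV[R]_N,
    (forall i, `|z i ord0 - x i ord0| <= d)%R -> (f z <= M)%R.
Proof.
move=> cf.
have {}cf y z t : (0 <= t <= 1 ->
    f (t *: y + (1 - t) *: z) <= t * f y + (1 - t) * f z)%R.
  by move=> t01; have := cf y z t t01; rewrite /= -!EFinM -!EFinD lee_fin.
suff bnd k : exists M d : R, (0 < d)%R /\ forall z : 'cV[R]_N,
    (forall i, `|z i ord0 - x i ord0| <= d)%R ->
    (forall i : 'I_N, k <= i -> z i ord0 = x i ord0)%N -> (f z <= M)%R.
  have [M [d [d0 H]]] := bnd N; exists M, d; split=> // z zd.
  by apply: H => // i; rewrite leqNgt ltn_ord.
elim: k => [|k [M [d [d0 IH]]]].
  exists (f x), 1%R; split=> // z _ zx.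
  by rewrite (_ : z = x)//; apply/matrixP => i j; rewrite ord1 zx.
have [kN|Nk] := ltnP k N; last first.
  exists M, d; split=> // z zd zx; apply: IH => // i ki; apply: zx.
  by have := leq_trans (ltn_ord i) (leq_trans Nk ki); rewrite ltnn.
pose i0 := Ordinal kN; pose e : 'cV[R]_N := delta_mx i0 ord0.
exists (2^-1 * M + 2^-1 * (`|f (x + e)| + `|f (x - e)|))%R.
(* The factor [d / 2] is there because [z1] below doubles deviations from [x]; the bound [1 / 2]
   keeps [s] in [[-1, 1]]. *)
exists (Num.min (d / 2) (1 / 2))%R; split.
  by rewrite lt_min !divr_gt0.
move=> z zd zx.
pose s := (2 * (z i0 ord0 - x i0 ord0))%R.
have : (- 1 <= s <= 1)%R.
  have := zd i0; rewrite le_min => /andP[_]; rewrite ler_norml /s => /andP[? ?].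
  by apply/andP; split; lra.
move=> /andP[s0 s1].
(* Coordinate [i0] is reset to that of [x], so the induction hypothesis applies; the shift along [e]
   is left to [z2 = x + s e]. *)
pose z1 : 'cV[R]_N :=
  (\col_i if i == i0 then x i ord0 else 2 * z i ord0 - x i ord0)%R.
have fz1 : (f z1 <= M)%R.
  apply: IH => i; rewrite mxE; last first.
    move=> ki; case: eqP => // /eqP ii0; rewrite zx ?mulr_natl ?mulr2n ?addrK//.
    by rewrite ltn_neqAle ki andbT; apply: contraNneq ii0 => ki'; apply/eqP/val_inj.
  case: eqP => _; first by rewrite subrr normr0 ltW.
  have := zd i; rewrite le_min => /andP[+ _]; rewrite !ler_norml => /andP[? ?].
  by apply/andP; split; lra.
(* The weight that puts [x + s e] on the segment from [x - e] to [x + e]. *)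
pose tau := ((1 + s) / 2)%R.
have tau01 : (0 <= tau <= 1)%R by rewrite /tau; apply/andP; split; lra.
have := cf (x + e)%R (x - e)%R _ tau01.
set z2 := (X in f X) => fz2.
have half01 : (0 <= (2^-1 : R) <= 1)%R by apply/andP; split; lra.
have zE : z = (2^-1 *: z1 + (1 - 2^-1) *: z2)%R.
  apply/matrixP => i j; rewrite !mxE ord1 eqxx andbT /tau /s.
  case: eqP => [->|_] /=; lra.
have /= := cf z1 z2 _ half01; rewrite -zE => /le_trans; apply.
suff : (f z2 <= `|f (x + e)| + `|f (x - e)|)%R by move=> ?; lra.
apply: (le_trans fz2); case/andP: tau01 => tau0 tau1; apply: lerD.
  apply: (le_trans (ler_wpM2l tau0 (ler_norm _))).
  by rewrite ler_piMl.
apply: (le_trans (ler_wpM2l _ (ler_norm _))); first by rewrite subr_ge0.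
by rewrite ler_piMl// lerBlDl lerDr.
Qed.

Lemma convex_lower_semicontinuous (N : nat) (f : 'cV[R]_N -> R) :
  convex_fun (EFin \o f) -> lower_semicontinuous (EFin \o f).
Proof.
move=> cf x a; rewrite /= lte_fin => afx.
have [M [d [d0 fM]]] := convex_locally_bounded x cf.
(* [D] is positive and exceeds [M - f x], so [eps * D = f x - a] yields [eps * (M - f x) < f x - a],
   the margin needed at the end. *)
pose D := (`|M - f x| + 1)%R.
have D0 : (0 < D)%R by rewrite ltr_wpDl.
pose eps := ((f x - a) / D)%R.
have eps0 : (0 < eps)%R by rewrite divr_gt0// subr_gt0.
exists (ball x (eps * d)%R); first by apply: nbhsx_ballx; rewrite mulr_gt0.
move=> w xw; rewrite /= lte_fin.
(* x lies between w and the reflected point x' = x + (x - w) / eps, where f is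
   at most M; convexity then bounds f w from below. *)
pose x' := (x + eps^-1 *: (x - w))%R.
have fx' : (f x' <= M)%R.
  apply: fM => i; rewrite !mxE addrAC subrr add0r normrM gtr0_norm ?invr_gt0//.
  by case: xw => _ xw; rewrite ler_pdivrMl//; exact/ltW/(xw i ord0).
(* The weight for which [x = t w + (1 - t) x']. Clearing it leaves
   [(1 + eps) f x <= f w + eps f x']. *)
pose t := ((1 + eps)^-1)%R.
have e1 : (0 < 1 + eps)%R by rewrite addr_gt0.
have t01 : (0 <= t <= 1)%R.
  by rewrite invr_ge0 (ltW e1) invf_le1// lerDl ltW.
have := cf w x' t t01; rewrite /= -!EFinM -!EFinD lee_fin.
have -> : (t *: w + (1 - t) *: x')%R = x.
  by apply/matrixP => i j; rewrite !mxE /t; field; rewrite !gt_eqF.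
have -> : (1 - t = eps * t)%R by rewrite /t; field; rewrite gt_eqF.
move=> /(ler_wpM2l (ltW e1)).
have -> : ((1 + eps) * (t * f w + eps * t * f x') = f w + eps * f x')%R.
  by rewrite /t; field; rewrite gt_eqF.
move=> fxw.
have epsM : (eps * (M - f x) < f x - a)%R.
  have -> : (f x - a = eps * D)%R by rewrite /eps divfK ?gt_eqF.
  by rewrite ltr_pM2l//; apply: le_lt_trans (ler_norm _) _; rewrite ltrDl.
have := ler_wpM2l (ltW eps0) fx'; lra.
Qed.

End convexity.

(** * The infimal term of the penalty, expressed by a conjugate *)

Section Moreau_envelope.
Context {R : realType}.

Lemma Moreau_conjugate (m q : nat) (B : 'M[R]_(q, m)) (psi : 'cV[R]_m -> \bar R)
    (u : 'cV[R]_m) :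
  (forall v, psi v \is a fin_num) ->
  ereal_inf [set psi v + (2^-1 * enorm (B *m (u - v)) ^+ 2)%:E | v in [set: 'cV[R]_m]]%classic
  = (2^-1 * enorm (B *m u) ^+ 2)%:E
    - conjugate (fun v => psi v + (2^-1 * enorm (B *m v) ^+ 2)%:E) (B^T *m B *m u).
Proof.
move=> psifin.
set c := (2^-1 * enorm (B *m u) ^+ 2)%R; pose g v := psi v + (2^-1 * enorm (B *m v) ^+ 2)%:E.
have gE v : psi v + (2^-1 * enorm (B *m (u - v)) ^+ 2)%:E
    = c%:E - ((dotp v (B^T *m B *m u))%:E - g v).
  rewrite /g -(fineK (psifin v)) -!EFinD; congr EFin.
  by rewrite mulmxBr enorm_sqrB -mulmxA -dotp_mulmxl /c (dotpC (B *m v)); field.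
under eq_imagel do rewrite gE.
rewrite /conjugate; set h := fun v => (dotp v _)%:E - g v.
(* The infimum of [c - h v] is [c] minus the supremum of [h]. Only [c] and the [h v] are known to be
   finite here, so terms are transposed with care. *)
apply/eqP; rewrite eq_le; apply/andP; split.
  rewrite -leeN2 oppeB ?fin_num_adde_defr// addeC leeBlDr//.
  apply: ge_ereal_sup => _ [v _ <-].
  rewrite -leeBlDr// leeNr oppeB ?fin_num_adde_defl// addeC.
  by apply: ereal_inf_lbound; exists v.
apply: le_ereal_inf_tmp => _ [v _ <-]; apply: leeB => //.
by apply: ereal_sup_ubound; exists v.
Qed.

(** At a point [B^T B u] the conjugate differs from a real number by the envelope, which lies
    between a lower bound of [psi] and [psi u] (take [v = u]). At other points it may be [+oo], for
    instance when [psi] and [B] vanish. *)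
Lemma conjugate_fin_num (m q : nat) (B : 'M[R]_(q, m)) (psi : 'cV[R]_m -> \bar R)
    (u : 'cV[R]_m) :
  bounded_below psi -> (forall v, psi v \is a fin_num) ->
  conjugate (fun v => psi v + (2^-1 * enorm (B *m v) ^+ 2)%:E) (B^T *m B *m u)
    \is a fin_num.
Proof.
move=> [c psic] psifin; have := Moreau_conjugate B u psifin.
set e := ereal_inf _ => eE.
have ce : c%:E <= e.
  apply: le_ereal_inf_tmp => _ [v _ <-]; rewrite -[c%:E]adde0; apply: leeD => //.
  by rewrite lee_fin mulr_ge0// sqr_ge0.
have epsi : e <= psi u.
  apply: ereal_inf_lbound; exists u => //.
  by rewrite subrr mulmx0 enorm_sqr dotpE mulmx0 mxE mulr0 adde0.
have : e \is a fin_num.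
  rewrite fin_numE -ltNye -ltey (lt_le_trans (ltNyr c) ce)/=.
  by apply: (le_lt_trans epsi); rewrite ltey_eq psifin.
by rewrite eE; case: (conjugate _ _).
Qed.

End Moreau_envelope.

(** * The cost function *)

Lemma cost_conjugate (R : realType) (d n m l q : nat)
    (A : 'M[R]_(d, n)) (y : 'cV[R]_d) (L : 'M[R]_(m, n)) (B : 'M[R]_(q, m))
    (lambda : R) (phi : 'cV[R]_m * 'cV[R]_l -> \bar R) (x : 'cV[R]_n) :
  bounded_below (MI_penalty phi) ->
  (forall u, MI_penalty phi u \is a fin_num) ->
  cost A y L B lambda phi x =
    (2^-1 * dotp x ((A^T *m A - lambda *: (L^T *m B^T *m B *m L)) *m x)
       - dotp y (A *m x) + 2^-1 * enorm y ^+ 2)%:E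
    + lambda%:E * MI_penalty phi (L *m x)
    + lambda%:E
      * conjugate (fun v => MI_penalty phi v + (2^-1 * enorm (B *m v) ^+ 2)%:E)
          (B^T *m B *m L *m x).
Proof.
move=> psibd psifin.
rewrite /cost /GME_MI_penalty Moreau_conjugate// -[(_ *m L *m x)%R]mulmxA.
rewrite -(fineK (psifin (L *m x)%R)).
rewrite -(fineK (conjugate_fin_num B (L *m x)%R psibd psifin)).
rewrite -!EFinB -!EFinM -!EFinD; congr EFin.
(* The term in [|B L x|^2] split off from the envelope joins [|A x|^2 / 2] to form the quadratic
   form of [Q]. *)
have -> : dotp x ((A^T *m A - lambda *: (L^T *m B^T *m B *m L)) *m x)%R
    = (enorm (A *m x) ^+ 2 - lambda * enorm (B *m (L *m x)) ^+ 2)%R.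
  rewrite mulmxBl -scalemxAl dotpBr dotpZr !enorm_sqr !dotp_mulmxl.
  by rewrite !mulmxA.
by rewrite enorm_sqrB; field.
Qed.

Theorem theorem1 (R : realType) (d n m l q : nat)
    (A : 'M[R]_(d, n)) (y : 'cV[R]_d) (L : 'M[R]_(m, n)) (B : 'M[R]_(q, m))
    (lambda : R) (phi : 'cV[R]_m * 'cV[R]_l -> \bar R)
    (hlambda : (0 < lambda)%R)
    (hphi : Gamma0 phi)
    (hbound : bounded_below phi)
    (hproper : forall u : 'cV[R]_m, proper_fun (fun s : 'cV[R]_l => phi (u, s)))
    (hcoer : forall u : 'cV[R]_m, coercive (fun s : 'cV[R]_l => phi (u, s))) :
  let psi := MI_penalty phi in
  let J := cost A y L B lambda phi in
  let Q : 'M[R]_n := (A^T *m A - lambda *: (L^T *m B^T *m B *m L))%R in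
  (forall x : 'cV[R]_n,
     J x = (2^-1 * dotp x (Q *m x) - dotp y (A *m x) + 2^-1 * enorm y ^+ 2)%:E
           + lambda%:E * psi (L *m x)
           + lambda%:E * conjugate (fun v => psi v + (2^-1 * enorm (B *m v) ^+ 2)%:E)
                                   (B^T *m B *m L *m x))
  /\ (psdmx Q -> Gamma0 J).
Proof.
move=> psi J Q.
have [[_ _] lscphi cphi] := hphi.
have psifin u : psi u \is a fin_num by exact: MI_penalty_fin_num.
have psibd : bounded_below psi.
  have [c phic] := hbound; exists c => u.
  by apply: le_ereal_inf_tmp => _ [s _ <-].
have JE x := cost_conjugate A y L B lambda x psibd psifin.
split=> // Qpsd.
pose g v := psi v + (2^-1 * enorm (B *m v) ^+ 2)%:E.
pose h x := conjugate g (B^T *m B *m L *m x)%R.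
have hfin x : h x \is a fin_num.
  by rewrite /h -mulmxA; exact: conjugate_fin_num.
have cpsi : convex_fun psi.
  apply: MI_penalty_convex => // u.
  by have [s [? _]] := MI_penalty_attained lscphi hbound (hproper u) (hcoer u); exists s.
pose p x := fine (psi (L *m x)%R).
have cp : convex_fun (EFin \o p).
  rewrite (_ : EFin \o p = fun x => psi (L *m x)%R); first exact: convex_fun_mulmx.
  by apply/funext => x; rewrite /p /= fineK.
have ch : convex_fun (EFin \o (fine \o h)).
  rewrite (_ : EFin \o _ = h); last by apply/funext => x; rewrite /= fineK.
  by apply: convex_fun_mulmx; apply: conjugate_convex => v; rewrite fin_numD psifin.
pose quad x :=
  (2^-1 * dotp x (Q *m x) - dotp (A^T *m y) x + 2^-1 * enorm y ^+ 2)%R.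
(* All terms being finite, [J] is a real function; this gives access to the sum and scaling rules
   and to lower semicontinuity. *)
pose Jr := (quad \+ lambda \*o p \+ lambda \*o (fine \o h))%R.
have JrE : J = EFin \o Jr.
  apply/funext => x; rewrite /J JE /= !EFinD !EFinM !fineK//.
  by rewrite dotp_mulmxl trmxK.
have cJ : convex_fun (EFin \o Jr).
  have l0 := ltW hlambda.
  do 2?[apply: convex_funD; last exact: convex_funZ].
  exact: convex_quadratic.
rewrite JrE; split => //; last exact: convex_lower_semicontinuous.
by split=> [x|]; [exact: ltNyr|exists 0%R; exact: ltry].
Qed.
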